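(* Let $k\ge 6$ be an even integer. Then for every integer $n\ge 0$, $$p_{S_k}(n)=(-1)^n\sum_{\substack{c\in\mathcal C_{P_k}\\ |c|=n}}(-1)^{\ell(c)}.$$
   Context: A composition is an ordered finite sequence of positive integers (including the empty one); $|c|$ is the sum of parts and $\ell(c)$ the number of parts; $\mathcal C_T$ is the set of compositions all of whose parts lie in $T$. For $k\ge3$, $P_k:=\{\,m((k-2)m\pm(k-4))/2 : m\in\mathbb N\,\}$ (the positive extended $k$-gonal numbers). For $k\ge5$, $S_k:=\{n\in\mathbb N: n\equiv 0,1,-1 \pmod{k-2}\}$. For $S\subseteq\mathbb N$, $p_S(n)$ is the number of partitions of $n$ all of whose parts lie in $S$ (with $p_S(0)=1$). *)

(* Defs.v *)
From mathcomp Require Import all_boot all_order all_algebra.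
Unset Printing Implicit Defensive.
Import Order.TTheory GRing.Theory Num.Theory.

(* P_k: positive extended k-gonal numbers  m((k-2)m +- (k-4))/2, m >= 1.
   For m >= 1 and k >= 4 such a value is >= m, so the witness m can be
   searched among 1..x. *)
Definition inP (k : nat) (x : nat) : bool :=
  (0 < x) &&
  has (fun m => (x.*2 == m * ((k - 2) * m + (k - 4))) ||
                (x.*2 == m * ((k - 2) * m - (k - 4))))
      (iota 1 x).

Definition inS (k : nat) (x : nat) : bool :=
  (0 < x) && [|| x %% (k - 2) == 0, x %% (k - 2) == 1 | x %% (k - 2) == k - 3].

Definition is_comp (T : pred nat) (n : nat) (c : seq nat) : bool :=
  all (fun x => 0 < x) c && all T c && (sumn c == n).

(* A composition of n has length <= n and parts <= n, so it is exactly
   (the map val of) an l.-tuple of 'I_n.+1 with l <= n. *)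

Definition comp_signed_sum (T : pred nat) (n : nat) : int :=
  \sum_(l < n.+1) \sum_(t : l.-tuple 'I_n.+1 | is_comp T n (map val t))
     (-1) ^+ (l : nat).

Definition partS_count (S : pred nat) (n : nat) : nat :=
  \sum_(l < n.+1)
     #|[pred t : l.-tuple 'I_n.+1 |
        is_comp S n (map val t) && sorted geq (map val t)]|.

(* Main.v *)
(* Put d = k - 2. The Jacobi triple product
     prod_(s in S_k) (1 - X^s) = sum_(m in Z) (-1)^m X^(m (d m + (d - 2)) / 2)
   runs over exactly the exponents in P_k, and for even k the exponent indexed by
   m has the parity of m, so the right-hand side is 1 + sum_(p in P_k) (-X)^p.
   The inverse of the left-hand side generates the partitions into parts in S_k,
   that of the right-hand side the signed compositions with parts in P_k, with X
   replaced by -X. The triple product is the limit of its finite form, which is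
   the q-binomial theorem after a change of variables. Power series are replaced
   by polynomials modulo X^(n+1). *)
Require Import Defs.
From mathcomp Require Import all_boot all_order all_algebra.
From mathcomp Require Import ring zify.
Import Order.TTheory GRing.Theory Num.Theory.
Local Open Scope ring_scope.

(** * Gaussian binomials and the q-binomial theorem *)

(** Defined by the q-Pascal rule rather than as a quotient, so that it exists for every [q] in a
    commutative ring. *)
Fixpoint qbinom {R : comNzRingType} (q : R) (n j : nat) : R :=
  match n, j with
  | _, 0 => 1
  | 0, _.+1 => 0
  | n'.+1, j'.+1 => qbinom q n' j + q ^+ (n' - j') * qbinom q n' j'
  end.

(** The q-Pochhammer symbol $(q;q)_n$. *)
Definition qfact {R : comNzRingType} (q : R) (n : nat) : R :=
  \prod_(i < n) (1 - q ^+ i.+1).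

Lemma qbinom0 {R : comNzRingType} (q : R) (n : nat) : qbinom q n 0 = 1.
Proof. by case: n. Qed.

Lemma qbinom_small {R : comNzRingType} (q : R) (n j : nat) :
  (n < j)%N -> qbinom q n j = 0.
Proof.
elim: n j => [|n IHn] [|j] //= lt_nj.
by rewrite !IHn ?mulr0 ?addr0 // ltnW.
Qed.

Lemma qbinomS {R : comNzRingType} (q : R) (n j : nat) :
  qbinom q n.+1 j.+1 = qbinom q n j.+1 + q ^+ (n - j) * qbinom q n j.
Proof. by []. Qed.

Lemma qfactS {R : comNzRingType} (q : R) (n : nat) :
  qfact q n.+1 = qfact q n * (1 - q ^+ n.+1).
Proof. by rewrite /qfact big_ord_recr. Qed.

Lemma qbinom_fact {R : comNzRingType} (q : R) (n j : nat) : (j <= n)%N ->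
  qbinom q n j * (qfact q j * qfact q (n - j)) = qfact q n.
Proof.
elim: n j => [|n IHn] [|j] // le_jn.
- by rewrite /= /qfact big_ord0 !mul1r.
- by rewrite qbinom0 subn0 {1}/qfact big_ord0 !mul1r.
rewrite qbinomS subSS mulrDl [qfact q n.+1]qfactS.
(* The two summands match the two terms of the q-Pascal rule. *)
have -> : 1 - q ^+ n.+1 = (1 - q ^+ (n - j)) + q ^+ (n - j) * (1 - q ^+ j.+1).
  rewrite mulrBr mulr1 -exprD addrA subrK; congr (_ - q ^+ _); lia.
rewrite mulrDr; congr (_ + _); last first.
  rewrite -(IHn j) // qfactS; ring.
move: le_jn; rewrite ltnS leq_eqVlt => /predU1P[->|lt_jn].
  by rewrite qbinom_small // subnn expr0 subrr mulr0 mul0r.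
rewrite -(IHn j.+1) // ?subSS.
have -> : (n - j = (n - j.+1).+1)%N by lia.
rewrite [qfact q (n - j.+1).+1]qfactS; ring.
Qed.

Lemma qbinomial_theorem {R : comNzRingType} (q x y : R) (n : nat) :
  \prod_(i < n) (y + x * q ^+ i)
  = \sum_(j < n.+1) q ^+ 'C(j, 2) * qbinom q n j * x ^+ j * y ^+ (n - j).
Proof.
elim: n => [|n IHn].
  by rewrite big_ord0 big_ord1 /= !expr0 !mulr1.
rewrite big_ord_recr /= IHn mulrDr.
rewrite [in RHS]big_ord_recl /= [X in X * y]big_ord_recl /= qbinom0 !subn0 !mulrDl.
rewrite -!addrA; congr (_ + _); first by rewrite exprSr !mulrA.
transitivity (\sum_(j < n.+1) (q ^+ 'C(j.+1, 2) * qbinom q n j.+1 * x ^+ j.+1 * y ^+ (n - j)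
  + q ^+ 'C(j.+1, 2) * (q ^+ (n - j) * qbinom q n j) * x ^+ j.+1 * y ^+ (n - j))); last first.
  by apply: eq_bigr => j _; rewrite /bump /= add1n subSS -!mulrDl -mulrDr.
rewrite big_split /=; congr (_ + _).
  rewrite [in RHS]big_ord_recr /= qbinom_small // mulr0 !mul0r addr0 mulr_suml.
  apply: eq_bigr => j _; rewrite /bump /= add1n -mulrA -exprSr; congr (_ * _ ^+ _).
  have := ltn_ord j; lia.
rewrite mulr_suml; apply: eq_bigr => j _.
(* The factor [q ^+ j] raises ['C(j, 2)] to ['C(j.+1, 2)]; [q ^+ (n - j)] is the Pascal weight. *)
have -> : q ^+ n = q ^+ j * q ^+ (n - j) by rewrite -exprD subnKC // -ltnS.
by rewrite binS bin1 exprD [x ^+ j.+1]exprS; ring.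
Qed.

(** * The finite triple product *)

Lemma bin2D (m n : nat) : 'C(m + n, 2) = ('C(m, 2) + 'C(n, 2) + m * n)%N.
Proof. by elim: n => [|n IHn]; rewrite ?addn0 ?muln0 ?addnS ?binS ?bin1 ?bin0n //; lia. Qed.

Lemma bin2_double (n : nat) : ('C(n, 2).*2 + n = n * n)%N.
Proof. by elim: n => // n IHn; rewrite binS bin1; lia. Qed.

(** With $Q = ab$, $-Q^N + aQ^i = aQ^i(1 - bQ^{N-i-1})$; reversing the index gives the product. *)
Lemma qprod_neg {R : comNzRingType} (a b : R) (N : nat) :
  \prod_(i < N) (- (a * b) ^+ N + a * (a * b) ^+ i)
  = a ^+ N * (a * b) ^+ 'C(N, 2) * \prod_(i < N) (1 - b * (a * b) ^+ i).
Proof.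
have -> : a ^+ N * (a * b) ^+ 'C(N, 2) = \prod_(i < N) (a * (a * b) ^+ i).
  rewrite big_split /= prodr_const card_ord; congr (_ * _).
  elim: N => [|N IHN]; first by rewrite big_ord0.
  by rewrite big_ord_recr /= -IHN binS bin1 exprD.
rewrite [X in _ = _ * X](reindex_inj rev_ord_inj) /= -big_split /=.
apply: eq_bigr => i _; rewrite mulrBr mulr1 addrC; congr (_ - _).
have {1}-> : (N = i + (N - i.+1).+1)%N by have := ltn_ord i; lia.
by rewrite exprD exprS; ring.
Qed.

Lemma qprod_pos {R : comNzRingType} (a b : R) (N : nat) :
  \prod_(i < N) (- (a * b) ^+ N + a * (a * b) ^+ (N + i))
  = (- (a * b) ^+ N) ^+ N * \prod_(i < N) (1 - a * (a * b) ^+ i).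
Proof.
have -> : (- (a * b) ^+ N) ^+ N = \prod_(i < N) (- (a * b) ^+ N).
  by rewrite prodr_const card_ord.
rewrite -big_split /=; apply: eq_bigr => i _.
rewrite exprD; ring.
Qed.

(* The q-binomial theorem with [x = a], [y = - (a b)^N] and [2 N] factors, divided by
   the nonzero common factor [c]. *)
Lemma finite_triple_product {R : idomainType} (a b : R) (N : nat) :
  a != 0 -> b != 0 ->
  (\prod_(i < N) (1 - a * (a * b) ^+ i)) * (\prod_(i < N) (1 - b * (a * b) ^+ i))
  = qbinom (a * b) (N + N) N
    + \sum_(m < N) (-1) ^+ m.+1 *
        (a ^+ 'C(m.+2, 2) * b ^+ 'C(m.+1, 2) * qbinom (a * b) (N + N) (N + m.+1)
         + a ^+ 'C(m.+1, 2) * b ^+ 'C(m.+2, 2) * qbinom (a * b) (N + N) (N - m.+1)).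
Proof.
move=> a0 b0; set Q := a * b.
pose c := (- Q ^+ N) ^+ N * (a ^+ N * Q ^+ 'C(N, 2)).
have c0 : c != 0 by rewrite /c /Q !(mulf_neq0, expf_neq0, oppr_eq0).
apply: (mulfI c0).
transitivity (\prod_(i < N + N) (- Q ^+ N + a * Q ^+ i)).
  by rewrite big_split_ord /= qprod_neg qprod_pos -/Q /c; ring.
rewrite qbinomial_theorem -addnS big_split_ord /= [X in _ + X]big_ord_recl /=.
rewrite addn0 addnK addrCA mulrDr; congr (_ + _).
  by rewrite /c; ring.
(* Reversing the lower half pairs the index [N - i.+1] with [N + i.+1]; the middle index [N] is
   already dealt with. *)
rewrite [X in X + _](reindex_inj rev_ord_inj) /= -big_split /= mulr_sumr.
apply: eq_bigr => i _; rewrite /bump /= add1n.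
have [r def_N] : exists r, N = (r + i.+1)%N.
  by exists (N - i.+1)%N; rewrite subnK.
set k := i.+1 in def_N *.
have -> : (N - k = r)%N by rewrite def_N addnK.
have -> : (N + N - r = N + k)%N by lia.
have -> : (N + N - (N + k) = r)%N by lia.
have sq : Q ^+ 'C(N, 2) * Q ^+ 'C(k, 2) * Q ^+ (N * k)  = Q ^+ 'C(N + k, 2).
  by rewrite -!exprD bin2D.
rewrite binS bin1 -/k mulrDr mulrDr addrC; congr (_ + _).
- transitivity (c * ((-1) ^+ k * (a ^+ k * Q ^+ 'C(k, 2) * qbinom Q (N + N) (N + k))));
    last first.
    by rewrite /Q exprMn exprD; ring.
  rewrite -sq /c.
  (* The exponent of [- Q ^+ N] is only [r] in this term, so the other [k] factors of [c] must be
     accounted for. *)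
  have -> : (- Q ^+ N) ^+ N = (- Q ^+ N) ^+ r * ((-1) ^+ k * Q ^+ (N * k)).
    by rewrite {2}def_N exprD [X in _ * X = _]exprNn exprM.
  have e1 : (-1) ^+ k * (-1) ^+ k = 1 :> R by rewrite -expr2 sqrr_sign.
  rewrite [a ^+ (N + k)]exprD.
  transitivity (((-1) ^+ k * (-1) ^+ k)
    * (Q ^+ 'C(N, 2) * Q ^+ 'C(k, 2) * Q ^+ (N * k) * qbinom Q (N + N) (N + k)
       * (a ^+ N * a ^+ k) * (- Q ^+ N) ^+ r)).
    by rewrite e1 mul1r.
  ring.
- transitivity ((- Q ^+ N) ^+ N * (Q ^+ ('C(N, 2) + 'C(k.+1, 2)) * a ^+ r)
                * ((-1) ^+ k * qbinom Q (N + N) r)); last first.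
    by rewrite /c [in a ^+ N]def_N binS bin1 /Q !exprD !exprMn; ring.
  rewrite exprD [X in _ * (_ * X) = _]exprNn -exprM.
  have -> : Q ^+ ('C(N, 2) + 'C(k.+1, 2)) = Q ^+ 'C(r, 2) * Q ^+ (N * k).
    rewrite -exprD; congr (_ ^+ _); rewrite binS bin1 def_N bin2D.
    by have := bin2_double k; lia.
  ring.
Qed.

(** * Congruence of polynomials modulo ['X^n] *)

Definition eq_modX {R : comNzRingType} (n : nat) (p q : {poly R}) : Prop :=
  forall i, (i < n)%N -> p`_i = q`_i.

Lemma eq_modX_refl {R : comNzRingType} (n : nat) (p : {poly R}) : eq_modX n p p.
Proof. by []. Qed.

Lemma eq_modX_sym {R : comNzRingType} (n : nat) (p q : {poly R}) :
  eq_modX n p q -> eq_modX n q p.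
Proof. by move=> pq i /pq. Qed.

Lemma eq_modX_trans {R : comNzRingType} (n : nat) (q p r : {poly R}) :
  eq_modX n p q -> eq_modX n q r -> eq_modX n p r.
Proof. by move=> pq qr i lt_in; rewrite pq ?qr. Qed.

Lemma eq_modXD {R : comNzRingType} (n : nat) (p p' q q' : {poly R}) :
  eq_modX n p p' -> eq_modX n q q' -> eq_modX n (p + q) (p' + q').
Proof. by move=> pp' qq' i lt_in; rewrite !coefD pp' ?qq'. Qed.

Lemma eq_modXM {R : comNzRingType} (n : nat) (p p' q q' : {poly R}) :
  eq_modX n p p' -> eq_modX n q q' -> eq_modX n (p * q) (p' * q').
Proof.
move=> pp' qq' i lt_in; rewrite !coefM; apply: eq_bigr => j _.
by rewrite pp' ?qq' //; have := ltn_ord j; lia.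
Qed.

Lemma eq_modX_sum {R : comNzRingType} (n : nat) (I : Type) (r : seq I)
    (P : pred I) (F G : I -> {poly R}) :
  (forall i, P i -> eq_modX n (F i) (G i)) ->
  eq_modX n (\sum_(i <- r | P i) F i) (\sum_(i <- r | P i) G i).
Proof.
move=> FG; elim/big_rec2: _ => [|i p q Pi]; first exact: eq_modX_refl.
by apply: eq_modXD; apply: FG.
Qed.

Lemma eq_modX_Xn {R : comNzRingType} (n m : nat) (p : {poly R}) :
  (n <= m)%N -> eq_modX n ('X^m * p) 0.
Proof. by move=> le_nm i lt_in; rewrite coefXnM coef0 (leq_trans lt_in). Qed.

Lemma eq_modX_exp {R : comNzRingType} (n : nat) (p : {poly R}) :
  p`_0 = 0 -> eq_modX n (p ^+ n) 0.
Proof.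
move=> p0; elim: n => [|n IHn] i // lt_in.
rewrite exprS coefM coef0 big1 // => -[[|j] /= lt_ji] _; first by rewrite p0 mul0r.
by rewrite IHn ?coef0 ?mulr0 //; lia.
Qed.

(** The product telescopes to $1 - (-p)^n$, and $X^n$ divides $(-p)^n$. *)
Lemma eq_modX_geometric {R : comNzRingType} (n : nat) (p : {poly R}) :
  p`_0 = 0 -> eq_modX n ((1 + p) * \sum_(l < n) (- p) ^+ l) 1.
Proof.
move=> p0.
have -> : (1 + p) * (\sum_(l < n) (- p) ^+ l) = 1 + - 1 * (- p) ^+ n.
  have := subrX1 (- p) n; set s := \sum_(l < n) _ => e.
  have -> : (- p) ^+ n = 1 + (- p - 1) * s by rewrite -e; ring.
  ring.
rewrite -[X in eq_modX n _ X]addr0 -[X in eq_modX n _ (1 + X)](mulr0 (-1)).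
apply/eq_modXD/eq_modXM => //; apply: eq_modX_exp.
by rewrite coefN p0 oppr0.
Qed.

(** A constant term 1 makes [p] invertible modulo ['X^n]: the inverse is the geometric sum for
    [p - 1]. *)
Lemma eq_modX_mulI {R : comNzRingType} (n : nat) (p q r : {poly R}) :
  p`_0 = 1 -> eq_modX n (p * q) (p * r) -> eq_modX n q r.
Proof.
move=> p0 pq_pr.
have := @eq_modX_geometric _ n (p - 1).
rewrite subrKC coefB coef1 p0 subrr => /(_ erefl); set s := \sum_(_ < _) _ => ps1.
have cancel t : eq_modX n (s * (p * t)) t.
  rewrite mulrA [s * p]mulrC -[X in eq_modX n _ X]mul1r.
  exact: eq_modXM.
apply: (eq_modX_trans _ _ _ _ (eq_modX_sym _ _ _ (cancel q))).
apply: (eq_modX_trans _ _ _ _ _ (cancel r)).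
exact: eq_modXM.
Qed.

(** * The triple product modulo ['X^n] *)

Lemma qfact_coef0 {R : comNzRingType} (d n : nat) : (0 < d)%N ->
  (qfact ('X^d : {poly R}) n)`_0 = 1.
Proof.
move=> d0; rewrite -horner_coef0 horner_prod big1 // => i _.
by rewrite -exprM !hornerE expr0n muln_eq0 -[d == 0]negbK -lt0n d0 subr0.
Qed.

(** Every factor after the first [n] is 1 modulo ['X^n]. *)
Lemma qfact_modX {R : comNzRingType} (d n m m' : nat) : (0 < d)%N ->
  (n <= m)%N -> (n <= m')%N ->
  eq_modX n (qfact ('X^d : {poly R}) m) (qfact 'X^d m').
Proof.
move=> d0 le_nm le_nm'.
have qfact_n k : (n <= k)%N -> eq_modX n (qfact ('X^d : {poly R}) k) (qfact 'X^d n).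
  elim: k => [|k IHk]; first by rewrite leqn0 => /eqP->.
  rewrite leq_eqVlt => /predU1P[<- //|le_nk].
  rewrite qfactS -[X in eq_modX _ _ X]mulr1; apply: eq_modXM; first exact: IHk.
  rewrite -[X in eq_modX _ _ X]addr0; apply: eq_modXD => //.
  rewrite -exprM -mulrN1; apply: eq_modX_Xn; nia.
by apply: eq_modX_trans (eq_modX_sym _ _ _ (qfact_n _ le_nm')); apply: qfact_n.
Qed.

(** Far from both ends a Gaussian binomial tends to $1/(q;q)_\infty$: in [qbinom_fact] all three
    q-factorials agree with [qfact 'X^d N]. *)
Lemma qbinom_modX {R : comNzRingType} (d n m j N : nat) : (0 < d)%N ->
  (n <= N)%N -> (n <= j)%N -> (n <= m - j)%N -> (j <= m)%N ->
  eq_modX n (qfact ('X^d : {poly R}) N * qbinom 'X^d m j) 1.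
Proof.
move=> d0 le_nN le_nj le_nmj le_jm.
apply: (eq_modX_mulI _ (qfact 'X^d N)); first exact: qfact_coef0.
rewrite mulr1 mulrA mulrC.
apply: (eq_modX_trans _ (qfact 'X^d m)); last by apply: qfact_modX => //; lia.
rewrite -(qbinom_fact _ _ _ le_jm).
by apply/eq_modXM/eq_modXM => //; apply: qfact_modX.
Qed.

(** The finite form at $a = X^u$, $b = X^v$, multiplied by a q-factorial that supplies the third
    family of factors and cancels the Gaussian binomials. *)
Lemma triple_product_modX {R : idomainType} (u v n : nat) :
  (0 < u)%N -> (0 < v)%N ->
  eq_modX n
    (\prod_(i < n.*2) ((1 - 'X^(u + (u + v) * i)) * (1 - 'X^(v + (u + v) * i))
                    * (1 - 'X^((u + v) * i.+1))))
    (1 + \sum_(m < n.*2) (-1) ^+ m.+1 *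
       ('X^(u * 'C(m.+2, 2) + v * 'C(m.+1, 2))
        + 'X^(u * 'C(m.+1, 2) + v * 'C(m.+2, 2))) : {poly R}).
Proof.
move=> u0 v0; move def_N: n.*2 => N; have d0 : (0 < u + v)%N by rewrite addn_gt0 u0.
have Xn0 k : 'X^k != 0 :> {poly R} by rewrite -size_poly_eq0 size_polyXn.
have -> : \prod_(i < N) ((1 - 'X^(u + (u + v) * i)) * (1 - 'X^(v + (u + v) * i))
                    * (1 - 'X^((u + v) * i.+1)))
  = qfact ('X^(u + v) : {poly R}) N *
    (\prod_(i < N) (1 - 'X^u * ('X^u * 'X^v) ^+ i)
     * \prod_(i < N) (1 - 'X^v * ('X^u * 'X^v) ^+ i)).
  rewrite /qfact -!big_split /=; apply: eq_bigr => i _.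
  by rewrite -!exprD -!exprM -!exprD mulrC.
rewrite finite_triple_product // -exprD mulrDr mulr_sumr.
apply: eq_modXD; first by apply: qbinom_modX => //; lia.
apply: eq_modX_sum => m _; rewrite mulrCA; apply: eq_modXM => //.
rewrite mulrDr -!exprM -!exprD.
have bin_ge : (m.+1 <= 'C(m.+2, 2))%N by rewrite binS bin1 leq_addl.
have term e j : (m.+1 <= e)%N -> (j <= N + N)%N -> (m < n -> n <= j /\ n <= N + N - j)%N ->
  eq_modX n (qfact 'X^(u + v) N * ('X^e * qbinom 'X^(u + v) (N + N) j)) ('X^e : {poly R}).
  move=> le_me le_jN small; rewrite mulrCA -[X in eq_modX _ _ X]mulr1.
  (* For [m < n], having [n.*2] factors keeps [j] at distance at least [n] from both ends; for
     larger [m] the exponent [e] exceeds [n] and both sides vanish. *)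
  have [lt_mn|le_nm] := ltnP m n.
    have [le_nj le_njN] := small lt_mn.
    by apply: eq_modXM => //; apply: qbinom_modX; rewrite //; lia.
  have le_ne : (n <= e)%N by apply: leq_trans (leqW le_nm) le_me.
  apply: (eq_modX_trans _ 0); first exact: eq_modX_Xn.
  exact/eq_modX_sym/eq_modX_Xn.
have := ltn_ord m; move=> lt_mN.
apply: eq_modXD; apply: term; nia.
Qed.

(** * Generating polynomials of partitions *)

(** Peels off the first part, the induction step for partitions and compositions alike. *)
Lemma big_tuple_cons {R : nmodType} (T : finType) (l : nat)
    (P : pred (seq T)) (F : seq T -> R) :
  \sum_(t : l.+1.-tuple T | P t) F t
  = \sum_x \sum_(t : l.-tuple T | P (x :: t)) F (x :: t).
Proof.
rewrite pair_big_dep /=.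
rewrite (reindex (fun p : T * l.-tuple T => [tuple of p.1 :: p.2])) //=.
exists (fun t : l.+1.-tuple T => (thead t, [tuple of behead t])) => [[x t] _|t _] /=.
  by congr (_, _); apply/val_inj.
by rewrite [RHS]tuple_eta; apply/val_inj.
Qed.

(* Generates the partitions into exactly [l] parts, all in [S] and at most [min b N], by
   recursion on the largest part. *)
Fixpoint part_poly (S : pred nat) (N l b : nat) : {poly int} :=
  if l is l'.+1 then
    \sum_(x < N.+1 | [&& (0 < x)%N, S x & (x <= b)%N]) 'X^x * part_poly S N l' x
  else 1.

Lemma part_polyE (S : pred nat) (N l b : nat) :
  part_poly S N l b =
  \sum_(t : l.-tuple 'I_N.+1 |
          [&& all (fun x => 0 < x)%N (map val t), all S (map val t)
            & path geq b (map val t)])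
    'X^(sumn (map val t)).
Proof.
elim: l b => [|l IHl] b /=.
  rewrite (big_pred1 [tuple]) ?expr0 // => t.
  by rewrite (tuple0 t) /= eqxx.
rewrite (big_tuple_cons _ _
  (fun s => [&& all (fun x => 0 < x)%N (map val s), all S (map val s)
              & path geq b (map val s)])
  (fun s => 'X^(sumn (map val s)))) /=.
rewrite big_mkcond; apply: eq_bigr => x _.
case: ifP => [/and3P[x0 Sx le_xb]|Px].
  rewrite IHl mulr_sumr; apply: eq_big => [t|t _]; last by rewrite exprD.
  by rewrite x0 Sx le_xb.
rewrite big1 // => t /and3P[/andP[x0 _] /andP[Sx _] /andP[le_xb _]].
by rewrite x0 Sx le_xb in Px.
Qed.

Lemma part_poly_coef (S : pred nat) (n : nat) :
  (\sum_(l < n.+1) part_poly S n l n)`_n = (partS_count S n)%:Z.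
Proof.
rewrite coef_sum /partS_count -natz natr_sum; apply: eq_bigr => l _.
rewrite part_polyE coef_sum -sum1_card natr_sum [RHS]big_mkcond [LHS]big_mkcond /=.
apply: eq_bigr => t _; rewrite inE /is_comp coefXn [n == _]eq_sym.
(* The entries lie in ['I_n.+1], so the bound [n] on the first part is automatic. *)
have -> : path geq n (map val t) = sorted geq (map val t).
  by case: t => -[|x s] //= _; rewrite -ltnS ltn_ord.
by case: all; case: all; case: sorted; case: eqP.
Qed.

(** The added term is the one with largest part [b.+1], an index of the sum because [b < N]. *)
Lemma part_polyS (S : pred nat) (N l b : nat) : (b < N)%N ->
  part_poly S N l.+1 b.+1
  = part_poly S N l.+1 b
    + (if S b.+1 then 'X^(b.+1) * part_poly S N l b.+1 else 0).
Proof.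
move=> lt_bN /=; pose y := Ordinal (lt_bN : b.+1 < N.+1)%N.
rewrite !(big_mkcond (fun x : 'I__ => [&& _, _ & _])) /=.
rewrite (bigD1 y) //= [in RHS](bigD1 y) //= leqnn ltnn !andbF add0r andbT addrC.
congr (_ + _); apply: eq_bigr => x neq_xy.
have neq_xb : (x : nat) != b.+1 by [].
by rewrite [(x <= b.+1)%N]leq_eqVlt (negbTE neq_xb).
Qed.

(** A sum of [l] positive parts is at least [l]. *)
Lemma part_poly_modX (S : pred nat) (N l b : nat) : eq_modX l (part_poly S N l b) 0.
Proof.
elim: l b => [|l IHl] b // i lt_il; rewrite coef0 coef_sum big1 //.
move=> x /and3P[x0 _ _]; rewrite coefXnM; case: ltnP => // le_xi.
by rewrite IHl ?coef0 //; lia.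
Qed.

(* Partitions with largest part exactly [b.+1] are those with parts at most [b.+1] with
   one more part [b.+1] added, so each new factor cancels. *)
Lemma part_poly_inv (S : pred nat) (N b : nat) : (b <= N)%N ->
  eq_modX N.+1
    ((\prod_(1 <= s < b.+1 | S s) (1 - 'X^s)) * \sum_(l < N.+1) part_poly S N l b) 1.
Proof.
elim: b => [|b IHb] le_bN.
  rewrite big_geq // mul1r big_ord_recl /= big1 ?addr0 // => l _.
  by apply: big1 => x /and3P[x0 _]; rewrite leqNgt x0.
apply: eq_modX_trans (IHb (ltnW le_bN)); rewrite big_mkcond big_nat_recr //= -big_mkcond.
rewrite -mulrA; apply: eq_modXM => //.
have part_poly0 c : part_poly S N ord0 c = 1 by [].
(* [part_polyS] summed over [l]. Removing one part lowers the length, so the last sum stops before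
   [l = N]. *)
have split_b : \sum_(l < N.+1) part_poly S N l b.+1
  = \sum_(l < N.+1) part_poly S N l b
    + (if S b.+1 then 'X^(b.+1) * \sum_(l < N) part_poly S N l b.+1 else 0).
  have -> : (if S b.+1 then 'X^(b.+1) * \sum_(l < N) part_poly S N l b.+1 else 0)
    = \sum_(l < N) (if S b.+1 then 'X^(b.+1) * part_poly S N l b.+1 else 0).
    by case: (S b.+1); [rewrite mulr_sumr | rewrite big1].
  rewrite !big_ord_recl !part_poly0 -addrA -big_split.
  by congr (_ + _); apply: eq_bigr => l _; rewrite lift0 part_polyS.
case: ifP split_b => Sb; last by rewrite addr0 mul1r => ->.
set F' := \sum_(l < N.+1) _; set F := \sum_(l < N.+1) _; set K := \sum_(l < N) _.
move=> F'E; have F'K : F' = K + part_poly S N N b.+1 by rewrite /F' big_ord_recr.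
(* The leftover from [l = N] is divisible by $X^{N+b+1}$, hence zero modulo $X^{N+1}$. *)
have -> : (1 - 'X^(b.+1)) * F' = F - 'X^(b.+1) * part_poly S N N b.+1.
  by rewrite mulrBl mul1r {1}F'E F'K; ring.
move=> i lt_iN; rewrite coefB coefXnM; case: ltnP => [_|le_bi]; first exact: subr0.
by rewrite part_poly_modX ?coef0 ?subr0 //; lia.
Qed.

(** * Generating polynomials of signed compositions *)

Definition composition_poly (T : pred nat) (n : nat) : {poly int} :=
  \sum_(x < n.+1 | (0 < x)%N && T x) (- 'X) ^+ x.

Lemma composition_poly_expE (T : pred nat) (n l : nat) :
  composition_poly T n ^+ l =
  \sum_(t : l.-tuple 'I_n.+1 | all (fun x => 0 < x)%N (map val t) && all T (map val t))
    (- 'X) ^+ sumn (map val t).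
Proof.
elim: l => [|l IHl].
  rewrite (big_pred1 [tuple]) ?expr0 // => t.
  by rewrite (tuple0 t) /= eqxx.
rewrite exprS IHl (big_tuple_cons _ _
  (fun s => all (fun x => 0 < x)%N (map val s) && all T (map val s))
  (fun s => (- 'X) ^+ sumn (map val s))) /=.
rewrite mulr_suml big_mkcond; apply: eq_bigr => x _.
case: ifP => [/andP[x0 Tx]|Px].
  rewrite mulr_sumr; apply: eq_big => [t|t _]; last by rewrite exprD.
  by rewrite x0 Tx.
rewrite big1 // => t /andP[/andP[x0 _] /andP[Tx _]].
by rewrite x0 Tx in Px.
Qed.

(** The [l]-th power enumerates compositions with [l] parts; the outer minus gives $(-1)^l$ and the
    variable [- 'X] gives $(-1)^n$. *)
Lemma composition_poly_coef (T : pred nat) (n : nat) :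
  (\sum_(l < n.+1) (- composition_poly T n) ^+ l)`_n = (-1) ^+ n * comp_signed_sum T n.
Proof.
rewrite coef_sum mulr_sumr; apply: eq_bigr => l _.
rewrite [(- composition_poly _ _) ^+ _]exprNn composition_poly_expE mulr_sumr coef_sum mulr_sumr.
rewrite [LHS]big_mkcond [RHS]big_mkcond; apply: eq_bigr => t _.
rewrite /is_comp; case: (all _ _ && all _ _) => //=.
have coef_sign k (p : {poly int}) : ((-1) ^+ k * p)`_n = (-1) ^+ k * p`_n.
  by rewrite -coefCM rmorphXn rmorphN1.
rewrite [(- 'X) ^+ _]exprNn !coef_sign coefXn [n == _]eq_sym.
by case: eqP => [->|_]; rewrite ?mulr0 // mulr1 mulrC.
Qed.

(** * The product over $S_k$ *)

(** Here $k = e + 5$ and $d = k - 2$. Each block $dN+1, \dots, dN+d$ meets $S_k$ in its first and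
    its last two elements. *)
Lemma prod_inS {R : comNzRingType} (F : nat -> R) (e N : nat) :
  (0 < e)%N -> let d := e.+3 in
  \prod_(1 <= s < (d * N).+1 | inS e.+4.+1 s) F s
  = \prod_(i < N) (F (1 + d * i)%N * F (e.+2 + d * i)%N * F (d * i.+1)%N).
Proof.
move=> e0 d; elim: N => [|N IHN]; first by rewrite muln0 big_geq // big_ord0.
rewrite (@big_cat_nat _ _ _ (d * N).+1) //=; last by lia.
rewrite IHN big_ord_recr /=; congr (_ * _).
have inSE j : (j < d)%N ->
    inS e.+4.+1 (j + (d * N).+1) = [|| j == 0, j == e.+1 | j == e.+2]%N.
  move=> lt_jd; rewrite /inS addnS /= !subSS !subn0 -addSn addnC mulnC modnMDl.
  (* Only for [j = e.+2] does [j.+1] wrap around modulo [d]. *)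
  move: lt_jd; rewrite /d; have [->|ne_j] := eqVneq j e.+2.
    by rewrite modnn /= !orbT.
  move=> lt_jd; rewrite modn_small; last by lia.
  by rewrite eqSS; lia.
rewrite -{1}[(d * N).+1]add0n big_addn (_ : ((d * N.+1).+1 - (d * N).+1)%N = d); last by lia.
rewrite big_mkcond big_nat_recl //= 2?big_nat_recr //= big_nat_cond big1 => [|j]; last first.
  move=> /andP[/andP[_ lt_je] _]; rewrite inSE; last by rewrite /d; lia.
  by rewrite ifF //; lia.
rewrite !inSE /d ?eqxx ?orbT //= mul1r mulrA.
by congr (F _ * F _ * F _); lia.
Qed.

Lemma prod_modX {R : comNzRingType} (S : pred nat) (n m : nat) : (n <= m)%N ->
  eq_modX n.+1 (\prod_(1 <= s < n.+1 | S s) (1 - 'X^s))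
               (\prod_(1 <= s < m.+1 | S s) (1 - 'X^s) : {poly R}).
Proof.
elim: m => [|m IHm]; first by rewrite leqn0 => /eqP->.
rewrite leq_eqVlt => /predU1P[<-|le_nm]; first exact: eq_modX_refl.
apply: (eq_modX_trans _ _ _ _ (IHm le_nm)).
rewrite [X in eq_modX _ _ X]big_mkcond big_nat_recr //= -big_mkcond.
rewrite -[X in eq_modX _ X]mulr1; apply: eq_modXM => //.
case: ifP => // _ i lt_in; rewrite coefB coefXn ltn_eqF ?subr0 //; lia.
Qed.

(** * Extended polygonal numbers *)

(* The two families [m ((v+1) m -+ (v-1)) / 2] of extended [(v+3)]-gonal numbers. *)
Definition gonal_minus (v m : nat) : nat := ('C(m.+1, 2) + v * 'C(m, 2))%N.
Definition gonal_plus (v m : nat) : nat := ('C(m, 2) + v * 'C(m.+1, 2))%N.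

Lemma gonal_minus_double (v m : nat) : (0 < v)%N ->
  (gonal_minus v m).*2 = (m * (v.+1 * m - v.-1))%N.
Proof.
move=> v0; rewrite /gonal_minus binS bin1 mulnBr.
have := bin2_double m; case: v v0 => // v _ /= eq_m.
have -> : (m * (v.+2 * m) = v.+2 * (m * m))%N by lia.
by rewrite -eq_m; lia.
Qed.

Lemma gonal_plus_double (v m : nat) : (0 < v)%N ->
  (gonal_plus v m).*2 = (m * (v.+1 * m + v.-1))%N.
Proof.
move=> v0; rewrite /gonal_plus binS bin1.
have := bin2_double m; case: v v0 => // v _ /= eq_m.
have -> : (m * (v.+2 * m + v) = v.+2 * (m * m) + m * v)%N by lia.
by rewrite -eq_m; lia.
Qed.

(** The value is $m + (v+1)\binom m2$ with $v + 1$ even; this is where the evenness of $k = v + 3$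
    enters. *)
Lemma odd_gonal_minus (v m : nat) : odd v -> odd (gonal_minus v m) = odd m.
Proof. by move=> ov; rewrite /gonal_minus binS bin1 !oddD oddM ov /=; case: odd; case: odd. Qed.

Lemma odd_gonal_plus (v m : nat) : odd v -> odd (gonal_plus v m) = odd m.
Proof. by move=> ov; rewrite /gonal_plus binS bin1 oddD oddM ov oddD /=; case: odd; case: odd. Qed.

(** The difference is $(v-1)m$. *)
Lemma gonal_minus_lt_plus (v m : nat) : (1 < v)%N -> (0 < m)%N ->
  (gonal_minus v m < gonal_plus v m)%N.
Proof. by move=> v1 m0; rewrite /gonal_minus /gonal_plus binS bin1; nia. Qed.

Lemma gonal_plus_lt_minus (v m m' : nat) : (m < m')%N ->
  (gonal_plus v m < gonal_minus v m')%N.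
Proof.
move=> lt_mm'; rewrite /gonal_minus /gonal_plus (binS m') bin1.
have := leq_mul (leqnn v) (leq_bin2l 2 lt_mm').
by have := leq_bin2l 2 (ltnW lt_mm'); lia.
Qed.

Lemma gonal_bounds (v m : nat) : (1 < v)%N -> (0 < m)%N ->
  (m <= gonal_minus v m < gonal_plus v m)%N.
Proof.
move=> v1 m0; rewrite gonal_minus_lt_plus // andbT /gonal_minus binS bin1; lia.
Qed.

(** The families interlace strictly: minus at 1, plus at 1, minus at 2, and so on. *)
Lemma gonal_uniq (v N : nat) : (1 < v)%N ->
  uniq (map (gonal_minus v) (iota 1 N) ++ map (gonal_plus v) (iota 1 N)).
Proof.
move=> v1; rewrite cat_uniq !map_inj_in_uniq ?iota_uniq.
- rewrite andbT /=; apply/hasPn => _ /mapP[y y_in ->]; apply/mapP => -[x x_in].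
  move: x_in y_in; rewrite !mem_iota => /andP[x0 _] /andP[y0 _].
  have := gonal_minus_lt_plus v x v1 x0; have := gonal_minus_lt_plus v y v1 y0.
  case: (ltngtP x y) => [lt|lt|->]; try have := gonal_plus_lt_minus v _ _ lt; lia.
- move=> x y; rewrite !mem_iota => /andP[x0 _] /andP[y0 _].
  have := gonal_minus_lt_plus v x v1 x0; have := gonal_minus_lt_plus v y v1 y0.
  case: (ltngtP x y) => [lt|lt|//]; have := gonal_plus_lt_minus v _ _ lt; lia.
- move=> x y; rewrite !mem_iota => /andP[x0 _] /andP[y0 _].
  have := gonal_minus_lt_plus v x v1 x0; have := gonal_minus_lt_plus v y v1 y0.
  case: (ltngtP x y) => [lt|lt|//]; have := gonal_plus_lt_minus v _ _ lt; lia.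
Qed.

(** An index never exceeds its value, so searching up to [x] or up to [N] finds the same
    witnesses. *)
Lemma inP_gonal (v N x : nat) : (1 < v)%N -> (x <= N)%N ->
  inP v.+3 x = (x \in map (gonal_minus v) (iota 1 N) ++ map (gonal_plus v) (iota 1 N)).
Proof.
move=> v1 le_xN; have v0 := ltnW v1.
have eqE m : (x.*2 == m * ((v.+3 - 2) * m + (v.+3 - 4)))%N
             || (x.*2 == m * ((v.+3 - 2) * m - (v.+3 - 4)))%N
           = (x == gonal_plus v m) || (x == gonal_minus v m).
  rewrite !subSS subn0 subn1 -gonal_plus_double // -gonal_minus_double //.
  by rewrite !(inj_eq double_inj).
rewrite /inP (eq_has eqE) mem_cat; apply/andP/orP.
- case=> x0 /hasP[m]; rewrite mem_iota => m_in /orP[] /eqP->; [right|left];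
    by apply: map_f; rewrite mem_iota; lia.
- have main m : m \in iota 1 N -> x = gonal_minus v m \/ x = gonal_plus v m ->
    (0 < x)%N /\ has (fun m => (x == gonal_plus v m) || (x == gonal_minus v m)) (iota 1 x).
    rewrite mem_iota => /andP[m0 _] xm; have ge := gonal_bounds v m v1 m0.
    split; first by lia.
    by apply/hasP; exists m; [rewrite mem_iota|]; lia.
  by case=> /mapP[m m_in xE]; apply: (main m) => //; [left|right].
Qed.

(** By parity $(-1)^m X^g = (-X)^g$ for both values $g$ of index $m$, so the sum depends only on the
    set of exponents. *)
Lemma sum_gonal (v n N : nat) : (1 < v)%N -> odd v -> (n <= N)%N ->
  eq_modX n.+1
    (\sum_(m < N) (-1) ^+ m.+1 * ('X^(gonal_minus v m.+1) + 'X^(gonal_plus v m.+1)))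
    (composition_poly (inP v.+3) n).
Proof.
move=> v1 ov le_nN.
set L := map (gonal_minus v) (iota 1 N) ++ map (gonal_plus v) (iota 1 N).
have -> : \sum_(m < N) (-1) ^+ m.+1 * ('X^(gonal_minus v m.+1) + 'X^(gonal_plus v m.+1))
    = \sum_(x <- L) (- 'X) ^+ x :> {poly int}.
  rewrite big_cat !big_map /= -big_split /=.
  rewrite (iotaDl 1 0) big_map -[N in iota 0 N]subn0 big_mkord.
  apply: eq_bigr => m _; rewrite add1n mulrDr.
  rewrite ![(- 'X) ^+ _]exprNn -[(-1) ^+ gonal_minus _ _]signr_odd odd_gonal_minus //.
  by rewrite -[(-1) ^+ gonal_plus _ _]signr_odd odd_gonal_plus // signr_odd.
apply: (eq_modX_trans _ (\sum_(x <- L | (x < n.+1)%N) (- 'X) ^+ x)).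
  rewrite [X in eq_modX _ _ X]big_mkcond; apply: eq_modX_sum => x _.
  case: ltnP => [//|le_nx]; rewrite exprNn mulrC; exact: eq_modX_Xn.
rewrite /composition_poly
  -(big_mkord (fun x => (0 < x)%N && inP v.+3 x) (fun x => (- 'X) ^+ x)).
rewrite -[\sum_(x <- L | _) _]big_filter -[\sum_(0 <= x < n.+1 | _) _]big_filter.
rewrite (perm_big [seq x <- index_iota 0 n.+1 | (0 < x)%N && inP v.+3 x]) //.
(* Both lists are free of repetitions, so each element of $P_k$ up to [n] occurs exactly once. *)
apply: uniq_perm; rewrite ?filter_uniq ?iota_uniq ?gonal_uniq //.
move=> x; rewrite !mem_filter mem_index_iota /= andbC.
case: ltnP => [le_xn|]; rewrite ?andbF // !andbT.
rewrite -inP_gonal //; last by lia.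
by rewrite /inP andbA andbb.
Qed.

(** * Comparing the two inverses *)

Theorem theorem1 (k : nat) (hk6 : (6 <= k)%N) (hkeven : ~~ odd k) (n : nat) :
  ((partS_count (inS k) n)%:Z = (-1) ^+ n * comp_signed_sum (inP k) n)%R.
Proof.
have [e def_k] : exists e, k = e.+4.+1 by exists (k - 5)%N; lia.
have e0 : (0 < e)%N by lia.
have odd_v : odd e.+2 by move: hkeven; rewrite def_k /= !negbK.
rewrite -part_poly_coef -composition_poly_coef {k hk6 hkeven}def_k.
set H := \sum_(l < _) _; set C := \sum_(l < _) _.
(* Precision [n.+1] is what reaches the coefficient of ['X^n]. *)
suff : eq_modX n.+1 H C by apply.
set Pi := \prod_(1 <= s < n.+1 | inS e.+4.+1 s) (1 - 'X^s : {poly int}).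
have PiH : eq_modX n.+1 (Pi * H) 1 by apply: part_poly_inv.
have G0 : (composition_poly (inP e.+4.+1) n)`_0 = 0.
  rewrite coef_sum big1 // => x /andP[x0 _].
  by rewrite -horner_coef0 !hornerE oppr0 expr0n -[_ == _]negbK -lt0n x0.
have GC : eq_modX n.+1 ((1 + composition_poly (inP e.+4.+1) n) * C) 1.
  exact: eq_modX_geometric.
have PiG : eq_modX n.+1 Pi (1 + composition_poly (inP e.+4.+1) n).
  (* The range is extended to [n.+1.*2] full blocks of length $k - 2$, as in the triple product for
     precision [n.+1]. *)
  apply: (eq_modX_trans _ _ _ _ (prod_modX _ n (e.+3 * n.+1.*2) _)); first by nia.
  rewrite prod_inS //.
  (* Taking $u = 1$ and $v = k - 3$ gives $u + v = k - 2$ and the residues $1$, $-1$, $0$. *)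
  apply: (eq_modX_trans _ _ _ _ (triple_product_modX 1 e.+2 n.+1 _ _)) => //.
  apply: eq_modXD => //.
  under eq_bigr => m _ do rewrite !mul1n.
  by apply: sum_gonal => //; lia.
(* [H] and [C] invert congruent polynomials: $H \equiv H(1+G)C \equiv (H\Pi)C \equiv C$, with $G$
   the composition polynomial and $\Pi$ the product [Pi]. *)
apply: (eq_modX_trans _ (H * ((1 + composition_poly (inP e.+4.+1) n) * C))).
  rewrite -[X in eq_modX _ X]mulr1; apply: eq_modXM => //; exact: eq_modX_sym.
rewrite -[X in eq_modX _ _ X]mul1r mulrA; apply: eq_modXM => //.
rewrite mulrC; apply: eq_modX_trans PiH; apply: eq_modXM => //; exact: eq_modX_sym.
Qed.
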